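(* Suppose $G=(V,E)$ is a cycle. Let $z^P$ be the solution value (the $S$-labeling number $SL_\phi(G)$ of the labeling $\phi$) obtained by the cycle algorithm, and let $z^D$ be the objective value in the dual problem $(D_{F2})$ of the dual solution obtained by the dual heuristic. Then $z^P=z^D$.
   Context: For a graph $G=(V,E)$ and a labeling $\phi:V\to\{1,\ldots,|V|\}$ of the nodes in which each label is used exactly once, the $S$-labeling number with respect to $\phi$ is $SL_\phi(G)=\sum_{\{u,v\}\in E}\min\{\phi(u),\phi(v)\}$. Dual problem $(D_{F2})$: with real variables $\alpha_k$ ($k\in\{1,\ldots,|V|\}$), $\beta_i$ ($i\in V$), $\gamma_e$ ($e\in E$), $\delta^k_e$ ($e\in E$, $k\in\{1,\ldots,|V|\}$), maximize $\sum_k\alpha_k+\sum_{i\in V}\beta_i+\sum_{e\in E}\gamma_e$ subject to $\alpha_k+\beta_i+\sum_{e\in E:\,i\in e}\delta^k_e\le 0$ for all $k$ and all $i\in V$; $\gamma_e-\delta^k_e\le k$ for all $e\in E$ and all $k$; $\delta^k_e\ge0$ for all $e\in E$ and all $k$. (This is the LP dual of the LP-relaxation of the formulation (F2): minimize $\sum_{e}\sum_k k\,d^k_e$ subject to $\sum_i x^k_i=1$ for all $k$, $\sum_k x^k_i=1$ for all $i$, $\sum_k d^k_e=1$ for all $e\in E$, $d^k_e\le x^k_i+x^k_{i'}$ for all $k$ and $e=\{i,i'\}\in E$, with all variables $x^k_i,d^k_e$ binary.) Dual heuristic: start with $\alpha=0$, $\beta=0$, $\delta=0$ and $\gamma_e=1$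 for all $e\in E$ (objective value $|E|$); let $\Delta$ be the maximum degree of a node of $G$. For $\bar k=1,2,\ldots,|V|$ in this order: if $|E|-\bar k\cdot\Delta>0$, then for each $k\le\bar k$ decrease $\alpha_k$ by $\Delta$ and increase $\delta^k_e$ by $1$ for all $e\in E$, and increase $\gamma_e$ by $1$ for all $e\in E$ (so the objective value changes by $|E|-\bar k\cdot\Delta$); otherwise stop. The output is the final $(\alpha,\beta,\gamma,\delta)$. Cycle algorithm: start with an arbitrary node and (going around the cycle, with even and odd referring to the position of a node in this order) label each even node with the smallest unused label; then label the odd nodes arbitrarily (with the remaining labels). *)

(* Defs.v *)
From HB Require Import structures.
From mathcomp Require Import all_boot all_order all_algebra.
From mathcomp Require Import reals.

Set Implicit Arguments.
Unset Strict Implicit.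
Unset Printing Implicit Defensive.

Import Order.TTheory GRing.Theory Num.Theory.
Local Open Scope ring_scope.

(* A graph on V is given by its edge set. *)
Definition simple_graph (V : finType) (E : {set {set V}}) : Prop :=
  forall e, e \in E -> #|e| = 2%N.

Definition adjacent (V : finType) (E : {set {set V}}) : rel V :=
  [rel u v | [set u; v] \in E].

Definition degree (V : finType) (E : {set {set V}}) (i : V) : nat :=
  #|[set e in E | i \in e]|.

Definition max_degree (V : finType) (E : {set {set V}}) : nat :=
  (\max_(i : V) degree E i)%N.

(* V = {v_0, ..., v_(n-1)} with n >= 3, and the edges are exactly the
   {v_i, v_(i+1 mod n)}. *)
Definition cycle_graph (V : finType) (E : {set {set V}}) : Prop :=
  exists s : seq V,
    [/\ uniq s, (3 <= size s)%N, forall v, v \in s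
      & E = [set [set v; next s v] | v : V]].

(* The labels 1, ..., |V| are encoded by 'I_#|V|: the index k : 'I_#|V|
   stands for the label k + 1.  This applies both to labelings and to the
   superscripts/subscripts k of the dual variables. *)
Definition label (n : nat) (k : 'I_n) : nat := k.+1.

(* The minimum over the two end nodes of e; the default value #|V| of the
   iterated minimum is the largest label. *)
Definition edge_min (V : finType) (phi : V -> 'I_#|V|) (e : {set V}) : nat :=
  \big[minn/#|V|]_(v in e) label (phi v).

Definition SL (V : finType) (E : {set {set V}}) (phi : V -> 'I_#|V|) : nat :=
  (\sum_(e in E) edge_min phi e)%N.

(* s lists all nodes, in the order in which they are met when going once
   around the cycle from the first node of s (arbitrary start and direction). *)
Definition goes_around (V : finType) (E : {set {set V}}) (s : seq V) : Prop :=
  ucycle (adjacent E) s /\ forall v, v \in s.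

(* Positions are counted from 0, so the starting node is an even node.  For an
   odd cycle this matters: the last node is then even as well. *)
Definition even_node (V : finType) (s : seq V) (v : V) : bool :=
  ~~ odd (index v s).

(* The labels already used when the even node v is about to be labeled. *)
Definition used_before (V : finType) (s : seq V) (phi : V -> 'I_#|V|) (v : V) :
    {set 'I_#|V|} :=
  [set phi u | u in V & even_node s u && (index u s < index v s)%N].

Definition smallest_unused (n : nat) (used : {set 'I_n}) (k : 'I_n) : Prop :=
  k \notin used /\ forall l, l \notin used -> (label k <= label l)%N.

(* phi is a possible output of the (nondeterministic) cycle algorithm: the
   order s and the labels of the odd nodes are arbitrary. *)
Definition cycle_algorithm (V : finType) (E : {set {set V}})
    (phi : V -> 'I_#|V|) : Prop :=
  exists s : seq V,
    [/\ goes_around E s, bijective phi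
      & forall v, even_node s v -> smallest_unused (used_before s phi v) (phi v)].

(* gamma and delta are total on {set V}; only their values at edges are
   meaningful, and only those occur in the objective and the constraints. *)
Record dual_point (R : Type) (V : finType) := DualPoint {
  alpha : 'I_#|V| -> R;
  beta  : V -> R;
  gamma : {set V} -> R;
  delta : 'I_#|V| -> {set V} -> R
}.

Definition dual_objective (R : realType) (V : finType) (E : {set {set V}})
    (d : dual_point R V) : R :=
  \sum_k alpha d k + \sum_i beta d i + \sum_(e in E) gamma d e.

Definition dual_feasible (R : realType) (V : finType) (E : {set {set V}})
    (d : dual_point R V) : Prop :=
  [/\ forall k i,
        alpha d k + beta d i + \sum_(e in E | i \in e) delta d k e <= 0,
      forall e k, e \in E -> gamma d e - delta d k e <= (label k)%:R
    & forall e k, e \in E -> 0 <= delta d k e].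

Definition dual_start (R : realType) (V : finType) : dual_point R V :=
  DualPoint (fun=> 0) (fun=> 0) (fun=> 1) (fun _ _ => 0).

Definition dual_step (R : realType) (V : finType) (E : {set {set V}})
    (kbar : nat) (d : dual_point R V) : dual_point R V :=
  DualPoint
    (fun k => if (label k <= kbar)%N then alpha d k - (max_degree E)%:R
              else alpha d k)
    (beta d)
    (fun e => gamma d e + 1)
    (fun k e => if (label k <= kbar)%N then delta d k e + 1 else delta d k e).

(* The rounds kbar, kbar + 1, ..., kbar + m - 1, stopping at the first round
   in which |E| - kbar * Delta > 0 fails. *)
Fixpoint dual_rounds (R : realType) (V : finType) (E : {set {set V}})
    (m kbar : nat) (d : dual_point R V) : dual_point R V :=
  if m is m'.+1 then
    if 0 < #|E|%:R - kbar%:R * (max_degree E)%:R :> R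
    then dual_rounds E m' kbar.+1 (dual_step E kbar d)
    else d
  else d.

Definition dual_heuristic (R : realType) (V : finType) (E : {set {set V}}) :
    dual_point R V :=
  dual_rounds E #|V| 1 (dual_start R V).

Lemma dual_heuristicE (R : realType) (V : finType) (E : {set {set V}}) :
  exists K : nat,
    [/\ forall k, alpha (dual_heuristic R E) k
                  = - ((K - k)%N%:R * (max_degree E)%:R),
        forall i, beta (dual_heuristic R E) i = 0,
        forall e, gamma (dual_heuristic R E) e = K.+1%:R
      & forall k e, delta (dual_heuristic R E) k e = (K - k)%N%:R].
Proof.
rewrite /dual_heuristic; set d0 := dual_start R V.
pose inv K (d : dual_point R V) :=
  [/\ forall k, alpha d k = - ((K - k)%N%:R * (max_degree E)%:R),
      forall i, beta d i = 0, forall e, gamma d e = K.+1%:R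
    & forall k e, delta d k e = (K - k)%N%:R].
suff H m : forall K d, inv K d -> exists K', inv K' (dual_rounds E m K.+1 d).
  by apply: (H _ 0%N); split=> *; rewrite /d0 /= ?sub0n ?mul0r ?oppr0.
elim: m => [|m IHm] K d dK /=; first by exists K.
case: ifP => _; last by exists K.
apply: IHm; case: dK => aK bK gK dK; split=> [k|i|e|k e] /=.
- rewrite aK /label ltnS; case: leqP => kK.
    by rewrite subSn // -[in RHS]natr1 mulrDl mul1r opprD.
  by have /eqP-> : (K - k == 0)%N; rewrite ?subn_eq0 1?ltnW //; move/eqP: kK => ->.
- exact: bK.
- by rewrite gK natr1.
- rewrite dK /label ltnS; case: leqP => kK; first by rewrite subSn // natr1.
  by have /eqP-> : (K - k == 0)%N; rewrite ?subn_eq0 1?ltnW //; move/eqP: kK => ->.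
Qed.

Lemma dual_heuristic_feasible (R : realType) (V : finType)
    (E : {set {set V}}) : dual_feasible E (dual_heuristic R E).
Proof.
have [K [aE bE gE dE]] := dual_heuristicE R E; split=> [k i|e k _|e k _].
- under eq_bigr do rewrite dE.
  rewrite aE bE addr0 sumr_const addrC subr_le0 -[leLHS]mulr_natr.
  apply: ler_wpM2l; first exact: ler0n.
  rewrite ler_nat /max_degree (leq_trans _ (leq_bigmax i)) // /degree.
  by rewrite leq_eqVlt; apply/orP; left; apply/eqP/eq_card => e; rewrite !inE.
- by rewrite gE dE lerBlDr -natrD ler_nat /label addSn ltnS -leq_subLR.
- by rewrite dE ler0n.
Qed.

(* Main.v *)
Require Import Defs.
From HB Require Import structures.
From mathcomp Require Import all_boot all_order all_algebra.
From mathcomp Require Import reals.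
From mathcomp Require Import ring zify.

Set Implicit Arguments.
Unset Strict Implicit.
Unset Printing Implicit Defensive.

Import Order.TTheory GRing.Theory Num.Theory.
Local Open Scope ring_scope.

(* If s_0, ..., s_(n-1) goes around the cycle, the algorithm gives s_(2j) the
   label j + 1, and every odd node gets a larger label than every even one.
   Hence the edge {s_i, s_(i+1)} contributes uphalf i + 1 for i < n - 1, and
   the closing edge {s_(n-1), s_0} contributes 1.  On the dual side the
   objective value is the sum over k = 0, ..., n of the positive parts of
   |E| - k * Delta = n - 2 k, and both sums satisfy
   z (n + 2) = z n + n + 2. *)

(** * Objective value of the output of the dual heuristic *)

Section DualValue.
Variables (R : realType) (V : finType) (E : {set {set V}}).

(** The bound on [k] ensures that exactly [k] of the variables [alpha] decrease. *)
Lemma dual_objective_step (k : nat) (d : dual_point R V) : (k <= #|V|)%N ->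
  dual_objective E (dual_step E k d) =
    dual_objective E d + (#|E|%:R - k%:R * (max_degree E)%:R).
Proof.
move=> le_kV; rewrite /dual_objective /=.
have -> : \sum_j (if (label j <= k)%N then alpha d j - (max_degree E)%:R
                  else alpha d j) =
          \sum_j alpha d j - k%:R * (max_degree E)%:R.
  have -> : k%:R * (max_degree E)%:R =
            \sum_(j : 'I_#|V| | (label j <= k)%N) (max_degree E)%:R :> R.
    by rewrite -(big_ord_widen _ (fun=> _)) // sumr_const card_ord mulr_natl.
  rewrite [X in _ - X]big_mkcond -sumrB; apply: eq_bigr => j _.
  by case: ifP; rewrite ?subr0.
by rewrite big_split /= sumr_const; ring.
Qed.

(** Truncated subtraction encodes the stopping rule: once a round fails, its term and all later ones
    are 0. *)
Lemma dual_objective_rounds (m k : nat) (d : dual_point R V) :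
  (k + m <= #|V|.+1)%N ->
  dual_objective E (dual_rounds E m k d) =
    dual_objective E d + (\sum_(k <= j < k + m) (#|E| - j * max_degree E))%:R.
Proof.
elim: m k d => [|m IHm] k d le_kmV /=; first by rewrite addn0 big_geq ?addr0.
rewrite -natrM subr_gt0 ltr_nat; case: ltnP => [lt_kE|le_Ek].
  have le_kV : (k <= #|V|)%N by lia.
  have lt_kkm : (k < k + m.+1)%N by lia.
  rewrite IHm ?addSnnS // dual_objective_step // -addrA [in RHS]big_ltn //.
  by rewrite natrD natrB 1?ltnW // natrM.
rewrite big_nat_cond big1 ?addr0 // => j /andP[/andP[le_kj _] _].
by apply/eqP; rewrite subn_eq0 (leq_trans le_Ek) // leq_mul2r le_kj orbT.
Qed.

Lemma dual_objective_heuristic :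
  dual_objective E (dual_heuristic R E) =
    (\sum_(j < #|V|.+1) (#|E| - j * max_degree E))%:R.
Proof.
rewrite dual_objective_rounds // -(big_mkord xpredT (fun j => _ - j * _)%N).
(* The term for index 0 is [#|E|], the objective value at the start. *)
rewrite [in RHS]big_ltn // natrD mul0n subn0 add1n; congr (_ + _).
by rewrite /dual_objective /= !big1_eq !add0r sumr_const.
Qed.

End DualValue.

(* minn has no neutral element, so edge_min only falls under semigroup laws. *)
HB.instance Definition _ := SemiGroup.isComLaw.Build nat minn minnA minnC.

(** * Nodes and edges of a cycle *)

Section Cycle.
Variables (V : finType) (s : seq V).
Hypotheses (s_uniq : uniq s) (s_ge3 : (3 <= size s)%N) (s_all : forall v, v \in s).

Let edge (v : V) : {set V} := [set v; next s v].

Lemma card_enum_seq : #|V| = size s.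
Proof. by rewrite -(card_uniqP s_uniq); apply: eq_card => v; rewrite s_all. Qed.

Lemma next_nth_mod (x : V) (i : nat) : (i < size s)%N ->
  next s (nth x s i) = nth x s (i.+1 %% size s).
Proof.
move=> lt_is; rewrite next_nth mem_nth // index_uniq //.
case: s lt_is => // y t /=; rewrite ltnS leq_eqVlt.
case/predU1P => [->|lt_it]; first by rewrite modnn nth_default.
by rewrite modn_small ?ltnS //=; apply: set_nth_default.
Qed.

(** Length at least 3 enters here; it keeps the edges leaving two distinct nodes from coinciding.
    The positions [n - 1] and [n - 2] wrap around and are treated separately. *)
Lemma next_next_neq (v : V) : next s (next s v) != v.
Proof.
have lt_vs : (index v s < size s)%N by rewrite index_mem.
rewrite -[in next s v](nth_index v (s_all v)) next_nth_mod //.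
rewrite next_nth_mod ?ltn_mod; last by lia.
rewrite -[X in _ != X](nth_index v (s_all v)).
rewrite nth_uniq ?ltn_mod //; last by lia.
move: lt_vs; set i := index v s; rewrite leq_eqVlt.
case/predU1P => [eq_is|lt_is].
  by rewrite eq_is modnn modn_small; lia.
rewrite (modn_small lt_is); move: lt_is; rewrite leq_eqVlt.
case/predU1P => [eq_is|lt_is]; first by rewrite eq_is modnn; lia.
by rewrite modn_small; lia.
Qed.

Lemma next_neq (v : V) : next s v != v.
Proof. by apply/eqP => eq_v; have := next_next_neq v; rewrite !eq_v eqxx. Qed.

(** Two distinct nodes with the same edge would be successors of each other. *)
Lemma edge_inj : injective edge.
Proof.
move=> u v eq_uv; apply/eqP; apply: contraT => neq_uv.
have: u \in edge v by rewrite -eq_uv set21.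
rewrite !inE (negPf neq_uv) => /eqP eq_u.
have: v \in edge u by rewrite eq_uv set21.
rewrite !inE eq_sym (negPf neq_uv) => /eqP eq_v.
by have := next_next_neq v; rewrite -eq_u -eq_v eqxx.
Qed.

Lemma card_cycle_edges : #|[set edge v | v : V]| = #|V|.
Proof. exact: card_imset edge_inj. Qed.

(** The edges at [v] are the one leaving [v] and the one leaving its predecessor. *)
Lemma degree_cycle (v : V) : degree [set edge u | u : V] v = 2.
Proof.
have neq_pv : prev s v != v.
  by apply/eqP => eq_v; have := next_neq v; rewrite -{1}eq_v next_prev ?eqxx.
have -> : degree [set edge u | u : V] v = #|[set edge v; edge (prev s v)]|.
  apply: eq_card => e; rewrite !inE; apply/andP/orP => [[/imsetP[u _ ->]]|].
    rewrite !inE => /orP[] /eqP->; first by left.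
    by right; rewrite prev_next.
  case=> /eqP->; first by rewrite imset_f ?set21.
  by rewrite imset_f // !inE next_prev // eqxx orbT.
by rewrite cards2 (inj_eq edge_inj) eq_sym neq_pv.
Qed.

Lemma max_degree_cycle : max_degree [set edge u | u : V] = 2.
Proof.
have /card_gt0P[v _] : (0 < #|V|)%N by rewrite card_enum_seq; lia.
apply/eqP; rewrite eqn_leq; apply/andP; split.
  by apply/bigmax_leqP => u _; rewrite degree_cycle.
by rewrite -(degree_cycle v); apply: leq_bigmax.
Qed.

Lemma edge_min_set2 (phi : V -> 'I_#|V|) (u v : V) : u != v ->
  edge_min phi [set u; v] = minn (label (phi u)) (label (phi v)).
Proof.
move=> neq_uv; rewrite /edge_min (bigD1 u) ?set21 //=.
rewrite (bigD1 v) /= ?set22 ?[v == u]eq_sym // big_pred0.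
  (* The default value [#|V|] is at least every label, so it drops out of the minimum. *)
  by congr minn; apply/minn_idPl; apply: ltn_ord.
by move=> w; rewrite !inE; case: eqP; case: eqP.
Qed.

(** * Labels given by the cycle algorithm *)

Section Labels.
Variable phi : V -> 'I_#|V|.
Hypotheses (phi_inj : injective phi)
  (phi_even : forall v, even_node s v -> smallest_unused (used_before s phi v) (phi v)).

Lemma even_label (x : V) (j : nat) : (j.*2 < size s)%N ->
  phi (nth x s j.*2) = j :> nat.
Proof.
elim/ltn_ind: j => j IHj lt_js; set v := nth x s j.*2.
have idx_v : index v s = j.*2 by rewrite index_uniq.
have [|phi_unused phi_min] := @phi_even v.
  by rewrite /even_node idx_v odd_double.
have lt_jV : (j < #|V|)%N by rewrite card_enum_seq; lia.
have usedE (l : 'I_#|V|) : (l \in used_before s phi v) = (l < j)%N.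
  apply/imsetP/idP => [[u] |lt_lj].
    rewrite !inE /= idx_v /even_node => /andP[even_u lt_u] ->.
    have eq_u : index u s = (index u s)./2.*2 by rewrite even_halfK.
    rewrite -(nth_index x (s_all u)) eq_u IHj; lia.
  have lt_ls : (l.*2 < size s)%N by lia.
  exists (nth x s l.*2); last by apply: val_inj; rewrite /= IHj.
  by rewrite !inE /even_node !index_uniq // odd_double ltn_double.
move: phi_unused; rewrite usedE -leqNgt => le_j.
have := phi_min (Ordinal lt_jV); rewrite usedE /label /= ltnn => /(_ isT).
by rewrite ltnS => ge_j; apply/eqP; rewrite eqn_leq ge_j.
Qed.

(** There are [uphalf (size s)] even positions, and their nodes take all smaller indices;
    injectivity excludes these for odd nodes. *)
Lemma odd_label (x : V) (i : nat) : odd i -> (i < size s)%N ->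
  (uphalf (size s) <= phi (nth x s i))%N.
Proof.
move=> odd_i lt_is; rewrite leqNgt; apply/negP => lt_phi.
set j : nat := phi _ in lt_phi.
have lt_js : (j.*2 < size s)%N by lia.
have /phi_inj/eqP : phi (nth x s j.*2) = phi (nth x s i).
  by apply: val_inj; rewrite /= even_label.
by rewrite nth_uniq // => /eqP eq_i; move: odd_i; rewrite -eq_i odd_double.
Qed.

(** For either parity of [i], the even end of the edge is at position [(uphalf i).*2], and it has
    the smaller label. *)
Lemma edge_min_inner (x : V) (i : nat) : (i.+1 < size s)%N ->
  edge_min phi (edge (nth x s i)) = (uphalf i).+1.
Proof.
move=> lt_is; rewrite edge_min_set2 1?eq_sym ?next_neq // next_nth_mod 1?ltnW //.
rewrite modn_small // /label minnSS; congr _.+1.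
case: (boolP (odd i)) => [odd_i|even_i].
  have := odd_label x odd_i (ltnW lt_is).
  have := @even_label x (uphalf i).
  have -> : (uphalf i).*2 = i.+1 by lia.
  by move=> /(_ lt_is) ->; lia.
have := odd_label x (i := i.+1); rewrite /= even_i => /(_ isT lt_is).
have := @even_label x i./2; rewrite even_halfK // => /(_ (ltnW lt_is)) ->.
by lia.
Qed.

(** The first node has label 1, so the parity of the last position does not matter. *)
Lemma edge_min_closing (x : V) :
  edge_min phi (edge (nth x s (size s).-1)) = 1%N.
Proof.
have s_gt0 : (0 < size s)%N by lia.
rewrite edge_min_set2 1?eq_sym ?next_neq // next_nth_mod ?prednK // modnn.
by rewrite /label (@even_label x 0) // minnSS minn0.
Qed.

Lemma SL_cycle :
  SL [set edge v | v : V] phi = (\sum_(i < (size s).-1) (uphalf i).+1).+1.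
Proof.
have /card_gt0P[x _] : (0 < #|V|)%N by rewrite card_enum_seq; lia.
rewrite /SL big_imset /=; last by move=> u v _ _; apply: edge_inj.
transitivity (\sum_(v <- s) edge_min phi (edge v))%N.
  rewrite [RHS]big_uniq //=; by apply: eq_bigl => v; rewrite s_all.
rewrite (big_nth x) big_mkord.
have -> : size s = (size s).-1.+1 by lia.
rewrite big_ord_recr /= edge_min_closing addn1; congr _.+1.
by apply: eq_bigr => i _; rewrite edge_min_inner //; have := ltn_ord i; lia.
Qed.

End Labels.
End Cycle.

(** Induction in steps of two, with 1 and 2 as base cases. *)
Lemma sum_uphalf_sum_sub_double (n : nat) : (0 < n)%N ->
  (\sum_(i < n.-1) (uphalf i).+1).+1 = (\sum_(j < n.+1) (n - j * 2))%N.
Proof.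
elim/ltn_ind: n => -[|[|[|n]]] // IHn _; do 2?by rewrite !big_ord_recl !big_ord0.
have /= {}IHn := IHn n.+1 (ltnW (ltnSn _)) isT.
rewrite !(big_ord_recr n.+1) (big_ord_recr n) -!addSn IHn /=.
(* The first term is [n.+3], the last is 0, and shifting the index by one turns the others into the
   sum for [n.+1]. *)
rewrite [in RHS]big_ord_recl [in RHS]big_ord_recr /=.
under [in RHS]eq_bigr => j _.
  rewrite (_ : n.+3 - bump 0 j * 2 = n.+1 - j * 2)%N; last by rewrite /bump; lia.
  over.
by rewrite /bump; lia.
Qed.

(** The order used by the algorithm need not be the one witnessing [cycle_graph]. Its successor
    edges lie in [E], and both sets have [#|V|] elements. *)
Lemma goes_around_edges (V : finType) (E : {set {set V}}) (s : seq V) :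
  cycle_graph E -> goes_around E s ->
  [/\ uniq s, (3 <= size s)%N, forall v, v \in s
    & E = [set [set v; next s v] | v : V]].
Proof.
move=> [t [t_uniq t_ge3 t_all E_t]] [/andP[s_cycle s_uniq] s_all].
have s_ge3 : (3 <= size s)%N.
  by rewrite -(card_enum_seq s_uniq s_all) (card_enum_seq t_uniq t_all).
split=> //; apply/esym/eqP; rewrite eqEcard; apply/andP; split.
  by apply/subsetP => _ /imsetP[v _ ->]; have := next_cycle s_cycle (s_all v).
by rewrite E_t !card_cycle_edges.
Qed.

Theorem theorem3 (R : realType) (V : finType) (E : {set {set V}})
    (phi : V -> 'I_#|V|)
    (graphE : simple_graph E) (cycleE : cycle_graph E)
    (phi_alg : cycle_algorithm E phi) :
  (SL E phi)%:R = dual_objective E (dual_heuristic R E).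
Proof.
have [s [s_around phi_bij phi_even]] := phi_alg.
have [s_uniq s_ge3 s_all E_s] := goes_around_edges cycleE s_around.
rewrite dual_objective_heuristic E_s (max_degree_cycle s_uniq) //.
rewrite card_cycle_edges // (SL_cycle s_uniq) //; last exact: bij_inj.
rewrite sum_uphalf_sum_sub_double ?(card_enum_seq s_uniq) //.
exact: leq_trans s_ge3.
Qed.
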